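(* Let $A$ be an $n\times n$ 0-1 matrix with row sums $r(1),\dots,r(n)$. Then $$\tilde M(A) := \prod_{i=1}^n \frac{g(r(i))}{e} \;\ge\; \operatorname{per}(A).$$
   Context: The permanent of an $n\times n$ matrix $A$ is $\operatorname{per}(A)=\sum_{\pi\in S_n}\prod_{i=1}^n A(i,\pi(i))$. The function $g$ is defined on nonnegative integers by $g(0):=0$, $g(1):=e$, and $$g(a+1) := g(a) + 1 + \frac{1}{2g(a)} + \frac{0.6}{g(a)^2}\qquad\text{for all integers } a\ge 1,$$ where $e$ is the base of the natural logarithm. *)

(* Defs.v *)
From mathcomp Require Import all_boot all_order all_algebra all_fingroup.
From mathcomp Require Import all_classical all_reals all_analysis.

Set Implicit Arguments.
Unset Strict Implicit.
Unset Printing Implicit Defensive.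

Import Order.TTheory GRing.Theory Num.Theory.

Local Open Scope ring_scope.

Definition per (K : comPzSemiRingType) (n : nat) (A : 'M[K]_n) : K :=
  \sum_(s : 'S_n) \prod_(i < n) A i (s i).

Definition zero_one_mx (n : nat) (A : 'M[nat]_n) : Prop :=
  forall i j, A i j = 0%N \/ A i j = 1%N.

Definition row_sum (n : nat) (A : 'M[nat]_n) (i : 'I_n) : nat :=
  (\sum_(j < n) A i j)%N.

Fixpoint g (R : realType) (a : nat) : R :=
  match a with
  | 0 => 0
  | b.+1 =>
      match b with
      | 0 => expR 1
      | _.+1 => g R b + 1 + 1 / (2 * g R b) + (6 / 10) / g R b ^+ 2
      end
  end.

Definition Mtilde (R : realType) (n : nat) (A : 'M[nat]_n) : R :=
  \prod_(i < n) (g R (row_sum A i) / expR 1).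

(* Main.v *)
(* Expanding along the first column and inducting on n, it suffices that the
   bounds of the minors met in the expansion sum to at most the bound of A. If S
   is the set of rows meeting that column and every r(k) >= 2 on S, the quotient
   of the two is prod_S (g(r(k)-1) / g(r(k))) * sum_S e / g(r(k)-1). With
   t_k = 1 / g(r(k)-1), the recursion multiplies g by
   1 + t_k + t_k^2/2 + 0.6 t_k^3 >= exp(t_k), so the quotient is at most
   e T exp(-T) <= 1 where T = sum_S t_k. If some r(k) = 1 on S, only the minor
   of row k has a nonzero bound, as g(0) = 0. *)
Require Import Defs.
From mathcomp Require Import all_boot all_order all_algebra all_fingroup.
From mathcomp Require Import all_classical all_reals all_analysis.
From mathcomp Require Import ring lra.

Set Implicit Arguments.
Unset Strict Implicit.
Unset Printing Implicit Defensive.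

Import Order.TTheory GRing.Theory Num.Theory.
Import numFieldNormedType.Exports.

Local Open Scope ring_scope.

(** For injectivity, [i] is recovered as the preimage of [j], and then [s] since lifting is
    injective; bijectivity follows by counting, as (n+1) n! = (n+1)!. *)
Lemma lift_perm_col_bij n (j : 'I_n.+1) :
  bijective (fun u : 'I_n.+1 * 'S_n => lift_perm u.1 j u.2).
Proof.
apply: inj_card_bij => [[i s] [i' s'] /= eq_ss'|]; last first.
  by rewrite card_prod card_ord !card_Sn factS.
have eq_ii' : i = i'.
  by apply: (@perm_inj _ (lift_perm i' j s')); rewrite -{1}eq_ss' !lift_perm_id.
subst i'; congr (_, _); apply/permP => k.
by apply: (@lift_inj _ j); rewrite -!(lift_perm_lift i) eq_ss'.
Qed.

Lemma big_neq_lift (T : Type) (idx : T) (op : Monoid.com_law idx) n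
    (i : 'I_n) (F : 'I_n -> T) :
  \big[op/idx]_(k | k != i) F k = \big[op/idx]_(k < n.-1) F (lift i k).
Proof.
rewrite (reindex_omap (lift i) (unlift i)) => [|k].
  by apply: eq_bigl => k; rewrite liftK eqxx andbT eq_sym neq_lift.
by rewrite eq_sym => /unlift_some[k' -> ->].
Qed.

(** Permutations are grouped by the row that they send to [j]. *)
Lemma per_expand_col (K : comPzSemiRingType) n (A : 'M[K]_n.+1) (j : 'I_n.+1) :
  per A = \sum_i A i j * per (row' i (col' j A)).
Proof.
rewrite /per (reindex _ (onW_bij _ (lift_perm_col_bij j))) /=.
rewrite -(pair_bigA _ (fun i s => \prod_k A k (lift_perm i j s k))) /=.
apply: eq_bigr => i _; rewrite big_distrr /=; apply: eq_bigr => s _.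
rewrite (bigD1_ord i) //= lift_perm_id; congr (_ * _).
by apply: eq_bigr => k _; rewrite lift_perm_lift !mxE.
Qed.

Section RealBounds.

Variable R : realType.

Implicit Types (t : R) (a : nat).

(* [(1 + t + t^2/2 + 6/10 t^3) e^(-t)] has derivative
   [(13/10 t^2 - 6/10 t^3) e^(-t)], nonnegative on [[0, 1]]. *)
Lemma expR_le_cubic t :
  0 <= t <= 1 -> expR t <= 1 + t + t ^+ 2 / 2 + 6 / 10 * t ^+ 3.
Proof.
move=> /andP[t0 t1].
pose f x : R := (1 + x + x ^+ 2 / 2 + 6 / 10 * x ^+ 3) * expR (- x).
have df (x : R) : is_derive x (1 : R) f ((13 / 10 * x ^+ 2 - 6 / 10 * x ^+ 3) * expR (- x)).
  rewrite /f; apply: is_derive_eq; rewrite /GRing.scale /=; by field.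
suff : f 0 <= f t.
  rewrite /f oppr0 expR0 expRN ler_pdivlMr ?expR_gt0 //.
  by rewrite !expr0n /=; lra.
apply: (@ger0_derive1_ndecr _ f 0 1) => // [x|].
  rewrite in_itv /= => /andP[x0 x1]; rewrite derive1E (@derive_val _ _ _ _ _ _ _ (df x)).
  by rewrite mulr_ge0 ?expR_ge0 //; nra.
by apply: derivable_within_continuous.
Qed.

Lemma g1 : g R 1 = expR 1. Proof. by []. Qed.

Lemma gSS a : g R a.+2 =
  g R a.+1 + 1 + 1 / (2 * g R a.+1) + (6 / 10) / g R a.+1 ^+ 2.
Proof. by []. Qed.

(** This puts the reciprocals of [g] in [0, 1], the range of [expR_le_cubic]. *)
Lemma g_gt1 a : 1 < g R a.+1.
Proof.
elim: a => [|a IH]; first by rewrite g1 expR_gt1.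
have g0 : 0 < g R a.+1 by lra.
rewrite gSS; have /ltW u := divr_gt0 ltr01 (mulr_gt0 (ltr0Sn R 1) g0).
have /ltW v : 0 < (6 / 10 : R) / g R a.+1 ^+ 2 by rewrite divr_gt0 ?exprn_gt0 //; lra.
lra.
Qed.

Lemma g_gt0 a : 0 < g R a.+1.
Proof. by rewrite (lt_trans ltr01) ?g_gt1. Qed.

Lemma g_ge0 a : 0 <= g R a.
Proof. by case: a => // a; rewrite ltW ?g_gt0. Qed.

Lemma g_expR_le a : g R a.+1 * expR (g R a.+1)^-1 <= g R a.+2.
Proof.
have gt1 := g_gt1 a; have gt0 := g_gt0 a.
have -> : g R a.+2 = g R a.+1 * (1 + (g R a.+1)^-1 + (g R a.+1)^-1 ^+ 2 / 2 +
    6 / 10 * (g R a.+1)^-1 ^+ 3) by rewrite gSS; field; rewrite gt_eqF.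
rewrite ler_pM2l //; apply: expR_le_cubic.
by rewrite invr_ge0 ltW //= invf_le1 // ltW.
Qed.

Lemma g_pred_le a : g R a.-1 <= g R a.
Proof.
case: a => [|[|a]]; [by [] | exact: g_ge0 | ].
apply: le_trans (g_expR_le a); rewrite ler_peMr ?g_ge0 //.
by rewrite -expR0 ler_expR invr_ge0 g_ge0.
Qed.

(** The line through the origin of slope e is tangent to the exponential at 1. *)
Lemma expR1_mul_le t : expR 1 * t <= expR t.
Proof.
rewrite -[in leRHS](subrKC 1 t) expRD ler_pM2l ?expR_gt0 //.
by have := expR_ge1Dx (t - 1); rewrite subrKC.
Qed.

Local Notation G a := (g R a / expR 1).

(** Here [S k] is coerced to 0 or 1, so that [r k - S k] is the sum of row [k] after the expanded
    column is deleted. *)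
Lemma sum_prod_g_le (I : finType) (S : pred I) (r : I -> nat) :
  (forall i, S i -> 0 < r i)%N ->
  \sum_(i | S i) \prod_(k | k != i) G (r k - S k)%N <= \prod_k G (r k).
Proof.
move=> r_gt0.
have G_ge0 a : 0 <= G a by rewrite divr_ge0 ?g_ge0 ?expR_ge0.
have G_sub_le k : G (r k - S k)%N <= G (r k).
  by case: (S k); rewrite ?subn0 // subn1 ler_pM2r ?invr_gt0 ?expR_gt0 ?g_pred_le.
have [/existsP[i /andP[Si /eqP ri1]]|] := boolP [exists i, S i && (r i == 1%N)].
  rewrite (bigD1 i) //= [X in _ + X]big1 ?addr0 => [|k /andP[_ ki]]; last first.
    (* Every summand other than that of [i] contains the factor [G 0 = 0] of row [i]. *)
    rewrite (bigD1 i) 1?eq_sym //= Si ri1 subnn mul0r mul0r //.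
  rewrite [leRHS](bigD1 i) //= ri1 g1 divff ?gt_eqF ?expR_gt0 // mul1r.
  by apply: ler_prod => k _; rewrite G_ge0 G_sub_le.
move=> /existsPn r_neq1.
have r_gt1 i : S i -> exists a, r i = a.+2.
  move=> Si; have := r_gt0 i Si; have := r_neq1 i; rewrite Si /=.
  by case: (r i) => [|[|a]] // _ _; exists a.
pose t k := (g R (r k - 1)%N)^-1.
(* Omitting row [i] from the full product amounts to multiplying by e [t i]; this needs
   [g (r i - 1)] nonzero, hence [r i >= 2]. *)
have -> : \sum_(i | S i) \prod_(k | k != i) G (r k - S k)%N =
    \prod_k G (r k - S k)%N * (expR 1 * \sum_(i | S i) t i).
  rewrite !big_distrr /=; apply: eq_bigr => i Si.
  rewrite [in RHS](bigD1 i) //= Si /t; have [a ->] := r_gt1 i Si.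
  rewrite subn1 /=.
  by field; rewrite !gt_eqF ?g_gt0 ?expR_gt0.
(* The exponential of the sum of the [t i] splits over the rows, so the comparison can be made
   factor by factor. *)
apply: le_trans (ler_wpM2l _ (expR1_mul_le _)) _; first exact: prodr_ge0.
rewrite expR_sum [X in _ * X]big_mkcond -big_split /=; apply: ler_prod => k _.
case: ifP => Sk; last by rewrite mulr1 G_ge0; have := G_sub_le k; rewrite Sk.
rewrite mulr_ge0 ?expR_ge0 ?G_ge0 //= mulrAC ler_pM2r ?invr_gt0 ?expR_gt0 //.
by rewrite /t; have [a ->] := r_gt1 k Sk; rewrite subn1 /= g_expR_le.
Qed.

End RealBounds.

Lemma zero_one_mx_minor n (A : 'M[nat]_n.+1) i j :
  zero_one_mx A -> zero_one_mx (row' i (col' j A)).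
Proof. by move=> hA k l; rewrite !mxE. Qed.

(** The truncated subtraction is exact, since the deleted entry is a term of the row sum. *)
Lemma row_sum_minor n (A : 'M[nat]_n.+1) i j k :
  row_sum (row' i (col' j A)) k = (row_sum A (lift i k) - A (lift i k) j)%N.
Proof.
rewrite /row_sum [in RHS](bigD1_ord j) //= addKn.
by apply: eq_bigr => l _; rewrite !mxE.
Qed.

Theorem lemma1 (R : realType) (n : nat) (A : 'M[nat]_n)
    (hA : zero_one_mx A) :
  Mtilde R A >= (per A)%:R.
Proof.
elim: n A hA => [|n IHn] A hA.
  rewrite /Mtilde /per big_ord0 (eq_bigr (fun=> 1%N)) => [|s _].
    by rewrite sum1_card card_Sn.
  by rewrite big_ord0.
pose S (i : 'I_n.+1) := A i ord0 == 1%N.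
(* Writing the entry as a coerced boolean gives the row sums of the minors the shape [r k - S k] of
   [sum_prod_g_le]. *)
have AS i : A i ord0 = S i by rewrite /S; case: (hA i ord0) => ->.
have r_gt0 i : S i -> (0 < row_sum A i)%N.
  by move=> /eqP Si; rewrite /row_sum big_ord_recl Si.
apply: le_trans (sum_prod_g_le R r_gt0).
rewrite (per_expand_col A ord0) natr_sum [leRHS]big_mkcond /=.
apply: ler_sum => i _; rewrite AS; case: (S i); last by rewrite mul0r.
rewrite mul1r; apply: le_trans (IHn _ (zero_one_mx_minor i ord0 hA)) _.
rewrite /Mtilde big_neq_lift; under eq_bigr do rewrite row_sum_minor AS.
by [].
Qed.
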